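(* Let $X$ and $Y$ be ordered linear spaces such that the cone $X_+$ is generating for $X$, $X_+$ has an internal point and $Y$ is a Dedekind complete lattice. Let $\mathcal L$ be a linear space of linear operators from $X$ to $Y$ that contains all regular operators from $X$ to $Y$ and consists of order bounded operators. Then for any finite collection $T = \{T_1, \ldots, T_n\} \subset \mathcal L$ such that the supremum $\sup T$ exists in $\mathcal L$, we have $(\sup T)(x) = \mathcal R(T; x)$ for every internal point $x$ of $X_+$.
   Context: All linear spaces are over $\mathbb R$. An ordered linear space $X$ is a linear space with a partial order such that $x \geqslant y$ and $\lambda \geqslant 0$ imply $x+z \geqslant y+z$ and $\lambda x \geqslant \lambda y$; $X_+ = \{x : x \geqslant 0\}$. $X_+$ is generating for $X$ if $X = X_+ - X_+$. A lattice is an ordered linear space in which any two elements have a supremum; $Y$ is Dedekind complete if every nonempty subset having an upper bound has a supremum. A point $e \in X_+$ is an internal point of $X_+$ if for every $x \in X$ there is $\varepsilon>0$ with $e+\alpha x \in X_+$ for all $\alpha \in (-\varepsilon,\varepsilon)$. A set is order bounded if it is contained in some $[x,y] = \{z : x \leqslant z \leqslant y\}$. A map is order bounded if it takes order bounded sets to order bounded sets. A linear operator $T : X \to Y$ is positive ($T \geqslant 0$) if $Tx \geqslant 0$ for all $x \in X_+$, and $S \geqslant T$ means $S-T \geqslant 0$; this is the order on $\mathcal L$. $T$ is regular if it is a difference of two positive linear operators. The Riesz-Kantorovich transform of $T = \{T_1,\dots,T_n\}$ is defined for $x \in X_+$ by $$\mathcal R(T;x) = \sup\Big\{ \sum_{j=1}^n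 T_j(x_j) : x_j \in X_+ \ (1 \leqslant j \leqslant n),\ \sum_{j=1}^n x_j \leqslant x\Big\}$$ (this supremum exists when the $T_j$ are order bounded and $Y$ is Dedekind complete).
   Formalization: With the constraint ''sum x_j ≤ x'' the claim fails (X = Y = ℝ, T = {−id}, x = 1: −1 versus 0); the formal theorem proves it with ''sum x_j = x'' for every T, and with ''sum x_j ≤ x'' when sup T ≥ 0. *)

(* Defs.v *)
From HB Require Import structures.
From mathcomp Require Import all_boot all_order all_algebra.
From mathcomp Require Import all_classical all_reals.

Set Implicit Arguments.
Unset Strict Implicit.
Unset Printing Implicit Defensive.

Import Order.TTheory GRing.Theory Num.Theory.

Local Open Scope classical_set_scope.
Local Open Scope ring_scope.

(* Num.POrderedZmodule only joins an order and an addition; the two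
   compatibility axioms are supplied here. *)
HB.mixin Record POrderedZmodule_isOrderedLmodule (R : numDomainType) V
    of GRing.Lmodule R V & Num.POrderedZmodule V := {
  ordered_lerD2r : forall x y z : V, y <= x -> y + z <= x + z ;
  ordered_lerZ : forall (a : R) (x y : V), 0 <= a -> y <= x -> a *: y <= a *: x
}.

#[short(type="orderedLmodType")]
HB.structure Definition OrderedLmodule (R : numDomainType) :=
  { V of GRing.Lmodule R V & Num.POrderedZmodule V
       & POrderedZmodule_isOrderedLmodule R V }.

Definition generating_cone (R : numDomainType) (X : orderedLmodType R) : Prop :=
  forall x : X, exists u v : X, [/\ 0 <= u, 0 <= v & x = u - v].

Definition internal_point (R : numDomainType) (X : orderedLmodType R)
    (e : X) : Prop :=
  0 <= e /\
  forall x : X, exists2 eps : R,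
    0 < eps & forall a : R, - eps < a < eps -> 0 <= e + a *: x.

Definition dedekind_complete_lattice (R : numDomainType)
    (Y : orderedLmodType R) : Prop :=
  (forall y z : Y, supremums [set y; z] !=set0) /\
  (forall A : set Y, A !=set0 -> has_ubound A -> supremums A !=set0).

Definition order_bounded_set (R : numDomainType) (X : orderedLmodType R)
    (A : set X) : Prop :=
  exists u v : X, forall z, A z -> u <= z <= v.

Section Operators.
Variables (R : numDomainType) (X Y : orderedLmodType R).
Implicit Types (S T U : X -> Y) (L : set (X -> Y)).

Definition order_bounded_map T : Prop :=
  forall A : set X, order_bounded_set A -> order_bounded_set (T @` A).

Definition positive_op T : Prop := forall x : X, 0 <= x -> 0 <= T x.

Definition regular_op T : Prop :=
  exists U V : X -> Y,
    [/\ linear U, linear V, positive_op U, positive_op V & T = U - V].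

(* Operators live in the linear space X -> Y with its pointwise operations,
   but their order is not the pointwise one: only X_+ matters. *)
Definition op_le S T : Prop := positive_op (T - S).

Definition linear_space_of_operators L : Prop :=
  [/\ L 0, forall (a : R) S T, L S -> L T -> L (a *: S + T)
    & forall T, L T -> linear T].

(* S is the supremum of T_1, ..., T_n computed inside L. *)
Definition op_sup_in L (n : nat) (T : 'I_n -> X -> Y) S : Prop :=
  [/\ L S, forall j, op_le (T j) S
    & forall U, L U -> (forall j, op_le (T j) U) -> op_le S U].

(* The two families of sums below differ in the constraint on the x_j. The
   supremum of rk_sums_le dominates 0 (take all x_j = 0), hence it can equal
   (sup T)(x) only if (sup T)(x) >= 0; for a single operator T_1 it computes
   the positive part T_1^+ rather than T_1. The supremum of rk_sums_eq is free
   of this restriction. *)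
Definition rk_sums_eq (n : nat) (T : 'I_n -> X -> Y) (x : X) : set Y :=
  [set y | exists xs : 'I_n -> X,
     [/\ forall j, 0 <= xs j, \sum_(j < n) xs j = x
       & y = \sum_(j < n) T j (xs j)]].

Definition rk_sums_le (n : nat) (T : 'I_n -> X -> Y) (x : X) : set Y :=
  [set y | exists xs : 'I_n -> X,
     [/\ forall j, 0 <= xs j, \sum_(j < n) xs j <= x
       & y = \sum_(j < n) T j (xs j)]].

End Operators.

(* Main.v *)
Require Import Defs.
From HB Require Import structures.
From mathcomp Require Import all_boot all_order all_algebra.
From mathcomp Require Import all_classical all_reals.

Set Implicit Arguments.
Unset Strict Implicit.
Unset Printing Implicit Defensive.

Import Order.TTheory GRing.Theory Num.Theory.

Local Open Scope classical_set_scope.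
Local Open Scope ring_scope.

(** The sum of the T_j x_j is at most the sum of the S x_j, so S x is an upper
    bound of the Riesz-Kantorovich sums at x. The point is that no upper bound
    z is smaller. For this it suffices to produce a linear U with U >= T_j for
    all j and U x <= z: the operator U - T_j is positive, hence regular, so
    U = (U - T_j) + T_j belongs to L, and the minimality of S gives S x <= U x <= z.

    Such a U is found by the Hahn-Banach-Kantorovich theorem
    ([sublinear_dominates_linear]) below the sublinear map
      q v = inf { t z - sum_j T_j w_j : t >= 0, w_j >= 0, v + sum_j w_j = t x }
    ([rk_majorant]). The decomposition of v = - w with t = 0 gives
    U (- w) <= - T_j w, that is T_j w <= U w, and the decomposition of x with
    t = 1 and w = 0 gives U x <= z. That x is internal ensures that every v has
    such a decomposition; that z is an upper bound ensures that the infimum is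
    finite. When z is the supremum R(T; x), U is a supergradient at x of the
    superlinear map R(T; .) on the cone X_+.

    Both the map q and the steps of the Hahn-Banach-Kantorovich theorem are
    infima of families that are closed, up to passing to a smaller element,
    under sums and positive multiples, and [sublinear_inf] treats them all at once. *)

(** * Ordered linear spaces *)

Lemma olerD (R : numDomainType) (V : orderedLmodType R) (a b c d : V) :
  a <= b -> c <= d -> a + c <= b + d.
Proof.
move=> ab cd; apply: (le_trans (ordered_lerD2r _ _ c ab)).
by rewrite addrC [b + d]addrC; exact: ordered_lerD2r.
Qed.

Lemma olerBlDr (R : numDomainType) (V : orderedLmodType R) (a b c : V) :
  (a - c <= b) = (a <= b + c).
Proof.
apply/idP/idP => h.
  by rewrite -(subrK c a); exact: ordered_lerD2r.
by rewrite -(addrK c b); exact: ordered_lerD2r.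
Qed.

Lemma osubr_ge0 (R : numDomainType) (V : orderedLmodType R) (a b : V) :
  (0 <= b - a) = (a <= b).
Proof.
apply/idP/idP => h.
  by rewrite -(subrK a b) -[leLHS]add0r; exact: ordered_lerD2r.
by rewrite -(subrr a); exact: ordered_lerD2r.
Qed.

Lemma oler_pZl (R : numFieldType) (V : orderedLmodType R) (t : R) (a b : V) :
  0 < t -> (t^-1 *: a <= b) = (a <= t *: b).
Proof.
move=> t0; have tn0 : t != 0 by rewrite gt_eqF.
apply/idP/idP => h.
  by rewrite -[leLHS](scalerKV tn0); apply: ordered_lerZ => //; exact: ltW.
rewrite -[leRHS](scalerK tn0); apply: ordered_lerZ => //.
by rewrite invr_ge0 ltW.
Qed.

Lemma oscaler_ge0 (R : numDomainType) (V : orderedLmodType R) (t : R) (v : V) :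
  0 <= t -> 0 <= v -> 0 <= t *: v.
Proof. by move=> t0 v0; rewrite -(scaler0 V t); exact: ordered_lerZ. Qed.

Lemma osumr_le (R : numDomainType) (V : orderedLmodType R) (I : finType)
    (F G : I -> V) :
  (forall i, F i <= G i) -> \sum_i F i <= \sum_i G i.
Proof.
move=> FG; elim/big_ind2: _ => // a b c d; exact: olerD.
Qed.

Lemma osumr_ge0 (R : numDomainType) (V : orderedLmodType R) (I : finType)
    (F : I -> V) :
  (forall i, 0 <= F i) -> 0 <= \sum_i F i.
Proof.
by move=> F0; elim/big_ind: _ => // a b a0 b0; rewrite -[0]addr0; exact: olerD.
Qed.

Lemma osumr_eq0 (R : numDomainType) (V : orderedLmodType R) (I : finType)
    (F : I -> V) :
  (forall i, 0 <= F i) -> \sum_i F i = 0 -> forall i, F i = 0.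
Proof.
move=> F0 sF i; apply/eqP; rewrite eq_le F0 andbT -sF (bigD1 i) //=.
rewrite -[leLHS]addr0; apply: olerD => //.
by rewrite big_mkcond; apply: osumr_ge0 => j; case: ifP.
Qed.

(** An internal point is an order unit: divide e - a v >= 0 by a small
    a > 0. *)
Lemma internal_order_unit (R : numFieldType) (X : orderedLmodType R) (e v : X) :
  internal_point e -> exists2 t : R, 0 < t & v <= t *: e.
Proof.
case=> _ /(_ (- v))[eps eps0 heps].
have e20 : 0 < eps / 2 by rewrite divr_gt0.
have := heps (eps / 2); rewrite ltr_pdivrMr // ltr_pMr // ltr1n.
rewrite (lt_trans _ e20) ?oppr_lt0 // => /(_ isT).
rewrite scalerN osubr_ge0 => h.
exists (eps / 2)^-1; first by rewrite invr_gt0.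
by rewrite -oler_pZl ?invr_gt0 // invrK.
Qed.

Lemma dedekind_complete_inf (R : numDomainType) (Y : orderedLmodType R)
    (A : set Y) :
  dedekind_complete_lattice Y -> A !=set0 -> has_lbound A -> infimums A !=set0.
Proof.
case=> _ Ycomp [a Aa] lA.
have ubl : has_ubound (lbound A) by exists a => b; exact.
have [m [ub_m lub_m]] := Ycomp _ lA ubl.
exists m; split=> // b Ab; apply: lub_m => c; exact.
Qed.

(** Operators range over a set of plain functions, so linearity comes as a
    proposition instead of a bundled morphism. *)
Lemma linear_fun_sum (R : pzRingType) (V W : lmodType R) (T : V -> W)
    (I : finType) (F : I -> V) :
  linear T -> T (\sum_i F i) = \sum_i T (F i).
Proof.
move=> Tlin; have TD u v : T (u + v) = T u + T v.
  by rewrite -[u]scale1r Tlin !scale1r.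
have T0 : T 0 = 0 by apply: (addIr (T 0)); rewrite -TD !add0r.
exact: (big_morph T TD T0).
Qed.

Lemma linear_fun_scale (R : pzRingType) (V W : lmodType R) (T : V -> W) (a : R) v :
  linear T -> T (a *: v) = a *: T v.
Proof.
move=> Tlin; have T0 : T 0 = 0.
  by apply: (addIr (T 0)); rewrite -[X in X + _]scale1r -Tlin scaler0 !add0r.
by rewrite -[a *: v]addr0 Tlin T0 addr0.
Qed.

(** * Sublinear maps and the Hahn-Banach-Kantorovich theorem *)

(** Only one inequality is asked in the homogeneity: applied to the inverse
    scalar it gives the other one, see [sublinearZ]. *)
Definition sublinear (R : numDomainType) (X Y : orderedLmodType R)
    (q : X -> Y) : Prop :=
  (forall u v, q (u + v) <= q u + q v) /\
  (forall (a : R) v, 0 < a -> q (a *: v) <= a *: q v).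

Lemma sublinearZ (R : numFieldType) (X Y : orderedLmodType R) (q : X -> Y)
    (a : R) (v : X) :
  sublinear q -> 0 < a -> q (a *: v) = a *: q v.
Proof.
case=> _ qZ a0; apply/eqP; rewrite eq_le qZ //=.
have ai0 : 0 < a^-1 by rewrite invr_gt0.
rewrite -[X in X *: _]invrK oler_pZl //.
by rewrite -[X in q X <= _](scalerK (lt0r_neq0 a0)) qZ.
Qed.

Lemma sublinear0 (R : numFieldType) (X Y : orderedLmodType R) (q : X -> Y) :
  sublinear q -> q 0 = 0.
Proof.
move=> qS; have := sublinearZ 0 qS (ltr0Sn R 1).
by rewrite scaler0 scaler_nat mulr2n -[LHS]addr0 => /addrI.
Qed.

(** An element of G v and one of G (- v) add up to at least an element of
    G 0, so each family is bounded below by the negatives of the opposite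
    one. *)
Lemma sublinear_inf (R : numFieldType) (X Y : orderedLmodType R)
    (G : X -> set Y) :
  dedekind_complete_lattice Y ->
  (forall u v a b, G u a -> G v b -> exists2 c, G (u + v) c & c <= a + b) ->
  (forall (t : R) v a, 0 < t -> G v a ->
     exists2 c, G (t *: v) c & c <= t *: a) ->
  (forall v, G v !=set0) ->
  (forall a, G 0 a -> 0 <= a) ->
  exists2 q : X -> Y, sublinear q & forall v, infimums (G v) (q v).
Proof.
move=> Ycomp GD GZ Gn0 G0.
have Ginf v : exists m, infimums (G v) m.
  apply: dedekind_complete_inf => //.
  have [b Gb] := Gn0 (- v); exists (- b) => a Ga.
  have [c] := GD _ _ _ _ Ga Gb; rewrite subrr => /G0 c0 cab.
  by rewrite -osubr_ge0 opprK; exact: le_trans cab.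
have [q qG] := choice Ginf; exists q => //; split=> [u v|t v t0].
- rewrite [leRHS]addrC -olerBlDr; apply: (qG v).2 => b Gb.
  rewrite olerBlDr [leRHS]addrC -olerBlDr; apply: (qG u).2 => a Ga.
  have [c Gc cab] := GD _ _ _ _ Ga Gb.
  by rewrite olerBlDr; apply: le_trans cab; exact: (qG _).1.
- rewrite -oler_pZl //; apply: (qG v).2 => a Ga.
  have [c Gc cta] := GZ _ _ _ t0 Ga.
  by rewrite oler_pZl //; apply: le_trans cta; exact: (qG _).1.
Qed.

(** For a fixed v the sublinear map p w = inf_(t >= 0) (q (w + t v) - t (q v))
    lies below q, hence equals q; its term t = 1 at w = u then gives
    q u + q v <= q (u + v), so that q is additive. *)
Lemma minimal_sublinear_linear (R : realFieldType) (X Y : orderedLmodType R)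
    (q : X -> Y) :
  dedekind_complete_lattice Y -> sublinear q ->
  (forall p : X -> Y, sublinear p -> (forall v, p v <= q v) ->
     forall v, q v <= p v) ->
  linear q.
Proof.
move=> Ycomp qS qmin; have q0 := sublinear0 qS.
have qD u v : q (u + v) = q u + q v.
  apply/eqP; rewrite eq_le qS.1 /=.
  pose G w := [set y | exists2 t : R, 0 <= t & y = q (w + t *: v) - t *: q v].
  have [w1 w2 a b [s s0 ->] [t t0 ->]|t w a t0 [s s0 ->]|w|a [t]|p pS pG] :=
      @sublinear_inf R X Y G Ycomp.
  - exists (q (w1 + w2 + (s + t) *: v) - (s + t) *: q v).
      by exists (s + t) => //; exact: addr_ge0.
    rewrite !scalerDl addrACA opprD [leRHS]addrACA.
    by apply: olerD => //; exact: qS.1.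
  - exists (q (t *: w + (t * s) *: v) - (t * s) *: q v).
      by exists (t * s) => //; rewrite mulr_ge0 // ltW.
    by rewrite -!scalerA -scalerDr sublinearZ // scalerBr.
  - by exists (q (w + 0 *: v) - 0 *: q v); exists 0.
  - rewrite le_eqVlt => /predU1P[<- ->|t0 ->].
      by rewrite !scale0r addr0 q0 subrr.
    by rewrite add0r sublinearZ // subrr.
  have pq w : p w <= q w.
    by apply: (pG w).1; exists 0 => //; rewrite !scale0r addr0 subr0.
  rewrite -[q v]opprK olerBlDr.
  apply: (le_trans (qmin _ pS pq u)); apply: (pG u).1.
  by exists 1; rewrite ?scale1r.
have qN v : q (- v) = - q v by apply/eqP; rewrite -addr_eq0 -qD addrC subrr q0.
move=> a u v; rewrite qD; congr (_ + _).
have [a0|a0|->] := ltgtP a 0; last by rewrite !scale0r.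
- rewrite -[a in LHS]opprK scaleNr qN sublinearZ ?oppr_gt0 //.
  by rewrite scaleNr opprK.
- by rewrite sublinearZ.
Qed.

(** Among the sublinear maps below q there is a minimal one by Zorn's lemma,
    and it is linear by [minimal_sublinear_linear]. The pointwise
    infimum of a chain is sublinear because the smaller of two members bounds
    its own value at u + v by the sum of the values of both at u and at v. *)
Lemma sublinear_dominates_linear (R : realFieldType) (X Y : orderedLmodType R)
    (q : X -> Y) :
  dedekind_complete_lattice Y -> sublinear q ->
  exists2 U : X -> Y, linear U & forall v, U v <= q v.
Proof.
move=> Ycomp qS.
pose below := {p : X -> Y | sublinear p /\ forall v, p v <= q v}.
pose ge (p r : below) := `[< forall v, sval r v <= sval p v >].
pose q' : below := exist _ q (conj qS (fun v => lexx (q v))).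
have [||A Atot|[p [pS pq]] pmin] := @ZL_preorder below q' ge.
- by move=> p; apply/asboolP.
- move=> p r s /asboolP pr /asboolP rs; apply/asboolP => v.
  exact: le_trans (pr v).
- have [->|/set0P[f Af]] := eqVneq A set0; first by exists q'.
  have below0 (p : below) : sval p 0 = 0 by exact: sublinear0 (svalP p).1.
  pose G v := [set y | exists2 p : below, A p & y = sval p v].
  have [u v a b [p Ap ->] [r Ar ->]|t v a t0 [p Ap ->]|v|a [p _ ->]|m mS mG] :=
      @sublinear_inf R X Y G Ycomp.
  + have [/asboolP rp|/asboolP pr] := Atot _ _ Ap Ar.
      exists (sval r (u + v)); first by exists r.
      by apply: (le_trans ((svalP r).1.1 u v)); exact: olerD.
    exists (sval p (u + v)); first by exists p.
    by apply: (le_trans ((svalP p).1.1 u v)); exact: olerD.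
  + by exists (sval p (t *: v)); [exists p|exact: (svalP p).1.2].
  + by exists (sval f v); exists f.
  + by rewrite below0.
  have mA p : A p -> forall v, m v <= sval p v.
    by move=> Ap v; apply: (mG v).1; exists p.
  have mq v : m v <= q v := le_trans (mA _ Af v) ((svalP f).2 v).
  by exists (exist _ m (conj mS mq)) => p Ap; apply/asboolP; exact: mA.
- exists p => //; apply: minimal_sublinear_linear => // r rS rp.
  have rq v : r v <= q v := le_trans (rp v) (pq v).
  by apply/asboolP/(pmin (exist _ r (conj rS rq)))/asboolP.
Qed.

(** * The sublinear map of the Riesz-Kantorovich sums *)

(** The map is q v = inf { t z - sum_j T_j w_j }, over the decompositions
    v + sum_j w_j = t x with t >= 0 and w_j >= 0. The value of a decomposition
    of 0 is nonnegative: if t > 0, dividing by t gives a decomposition of x,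
    whose sum z bounds; if t = 0, antisymmetry of the order forces every w_j to
    vanish. The index j0 makes sure that there is a w_j to absorb t x - v. *)
Lemma rk_majorant (R : realFieldType) (X Y : orderedLmodType R) (n : nat)
    (T : 'I_n -> X -> Y) (x : X) (z : Y) (j0 : 'I_n) :
  dedekind_complete_lattice Y -> internal_point x ->
  (forall j, linear (T j)) -> ubound (rk_sums_eq T x) z ->
  exists q : X -> Y,
    [/\ sublinear q, q x <= z & forall j w, 0 <= w -> q (- w) <= - T j w].
Proof.
move=> Ycomp xint Tlin zub.
have T0 j : T j 0 = 0 by rewrite -(scale0r 0) linear_fun_scale // scale0r.
have TD j u v : T j (u + v) = T j u + T j v.
  by rewrite -[u]scale1r Tlin !scale1r.
pose G v := [set y | exists (t : R) (ws : 'I_n -> X),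
  [/\ 0 <= t, forall j, 0 <= ws j, v + \sum_j ws j = t *: x &
      y = t *: z - \sum_j T j (ws j)]].
pose single (j : 'I_n) (w : X) i := if i == j then w else 0.
have single_ge0 j w : 0 <= w -> forall i, 0 <= single j w i.
  by move=> w0 i; rewrite /single; case: ifP.
have sum_single j w : \sum_i single j w i = w.
  by rewrite /single -big_mkcond big_pred1_eq.
have sumT_single j w : \sum_i T i (single j w i) = T j w.
  rewrite (bigD1 j) //= big1 => [|i ij]; rewrite /single.
    by rewrite eqxx addr0.
  by rewrite (negPf ij) T0.
have [u v a b|t v a|v|a|q qS qG] := @sublinear_inf R X Y G Ycomp.
- move=> [s [us [s0 us0 su ->]]] [t [vs [t0 vs0 sv ->]]].
  exists ((s + t) *: z - \sum_j T j (us j + vs j)).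
    exists (s + t), (fun j => us j + vs j); split => //.
    + exact: addr_ge0.
    + by move=> j; rewrite -[0]addr0; exact: olerD.
    + by rewrite big_split /= addrACA su sv scalerDl.
  under eq_bigr do rewrite TD.
  by rewrite big_split /= scalerDl opprD addrACA.
- move=> t0 [s [vs [s0 vs0 sv ->]]].
  exists ((t * s) *: z - \sum_j T j (t *: vs j)).
    exists (t * s), (fun j => t *: vs j); split => //.
    + by rewrite mulr_ge0 // ltW.
    + by move=> j; rewrite oscaler_ge0 // ltW.
    + by rewrite -scaler_sumr -scalerDr sv scalerA.
  under eq_bigr do rewrite linear_fun_scale //.
  by rewrite -scaler_sumr -scalerA scalerBr.
- have [t t0 vt] := internal_order_unit v xint.
  exists (t *: z - \sum_j T j (single j0 (t *: x - v) j)).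
  exists t, (single j0 (t *: x - v)); split => //; first exact: ltW.
    by apply: single_ge0; rewrite osubr_ge0.
  by rewrite sum_single addrC subrK.
- move=> [t [ws [+ ws0]]]; rewrite add0r le_eqVlt.
  move=> /predU1P[<-|t0] sws ->.
    rewrite scale0r in sws; rewrite scale0r sub0r big1 ?oppr0 // => j _.
    by rewrite (osumr_eq0 ws0 sws).
  rewrite osubr_ge0 -oler_pZl // scaler_sumr.
  apply: zub; exists (fun j => t^-1 *: ws j); split.
  + by move=> j; rewrite oscaler_ge0 // invr_ge0 ltW.
  + by rewrite -scaler_sumr sws scalerK // gt_eqF.
  + by apply: eq_bigr => j _; rewrite linear_fun_scale.
exists q; split => // [|j w w0].
(* x = 1 x, and - w + w = 0 x with w in position j *)
- apply: (qG x).1; exists 1, (fun=> 0); split => //.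
    by rewrite big1 // addr0 scale1r.
  by rewrite scale1r big1 ?subr0.
- apply: (qG (- w)).1; exists 0, (single j w); split => //.
  + exact: single_ge0.
  + by rewrite sum_single addrC subrr scale0r.
  + by rewrite sumT_single scale0r sub0r.
Qed.

(** For z = R(T; x), such a U is a supergradient of R(T; .) at x: every
    linear majorant of the T_j dominates R(T; .), and this one meets it at
    x. *)
Lemma rk_supergradient (R : realFieldType) (X Y : orderedLmodType R) (n : nat)
    (T : 'I_n -> X -> Y) (x : X) (z : Y) (j0 : 'I_n) :
  dedekind_complete_lattice Y -> internal_point x ->
  (forall j, linear (T j)) -> ubound (rk_sums_eq T x) z ->
  exists U : X -> Y, [/\ linear U, forall j, op_le (T j) U & U x <= z].
Proof.
move=> Ycomp xint Tlin zub.
have [q [qS qx qT]] := rk_majorant j0 Ycomp xint Tlin zub.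
have [U Ulin Uq] := sublinear_dominates_linear Ycomp qS.
exists U; split => // [j w w0|]; last exact: le_trans (Uq x) qx.
have := le_trans (Uq _) (qT j w w0).
by rewrite -scaleN1r linear_fun_scale // scaleN1r -osubr_ge0 opprK addrC.
Qed.

Lemma rk_sums_eq_le (R : numDomainType) (X Y : orderedLmodType R) (n : nat)
    (T : 'I_n -> X -> Y) (x : X) :
  rk_sums_eq T x `<=` rk_sums_le T x.
Proof. by move=> y [xs [xs0 <- ->]]; exists xs. Qed.

Lemma rk_sum_le_majorant (R : numDomainType) (X Y : orderedLmodType R)
    (n : nat) (T : 'I_n -> X -> Y) (S : X -> Y) (xs : 'I_n -> X) :
  linear S -> (forall j, op_le (T j) S) -> (forall j, 0 <= xs j) ->
  \sum_j T j (xs j) <= S (\sum_j xs j).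
Proof.
move=> Slin TS xs0; rewrite linear_fun_sum //; apply: osumr_le => j.
by rewrite -osubr_ge0; exact: TS.
Qed.

Theorem theorem21 (R : realType) (X Y : orderedLmodType R)
    (X_generating : generating_cone X)
    (X_internal : exists e : X, internal_point e)
    (Y_complete : dedekind_complete_lattice Y)
    (L : set (X -> Y))
    (L_linear : linear_space_of_operators L)
    (L_regular : forall T : X -> Y, regular_op T -> L T)
    (L_bounded : forall T : X -> Y, L T -> order_bounded_map T)
    (n : nat) (n_gt0 : (0 < n)%N) (T : 'I_n -> X -> Y)
    (T_in_L : forall j, L (T j))
    (S : X -> Y) (S_sup : op_sup_in L T S)
    (x : X) (x_internal : internal_point x) :
  supremums (rk_sums_eq T x) (S x) /\
  (positive_op S -> supremums (rk_sums_le T x) (S x)).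
Proof.
have [_ Lcomb Llin] := L_linear; have [LS TS Smin] := S_sup.
have Slin := Llin _ LS; have Tlin j := Llin _ (T_in_L j).
pose j0 := Ordinal n_gt0.
have Sx_least : lbound (ubound (rk_sums_eq T x)) (S x).
  move=> z zub.
  have [U [Ulin TU Uxz]] := rk_supergradient j0 Y_complete x_internal Tlin zub.
  (* U = (U - T j0) + T j0, where U - T j0 is positive and thus regular *)
  have LU : L U.
    rewrite -[U](subrK (T j0)) -[U - T j0]scale1r; apply: Lcomb => //.
    apply: L_regular; exists (U - T j0), 0; split => //.
    - move=> a u v; rewrite -[LHS]/(U _ - T j0 _) Ulin Tlin.
      by rewrite opprD addrACA -scalerBr.
    - by move=> a u v; rewrite scaler0 addr0.
    - exact: TU.
    - by rewrite subr0.
  apply: le_trans Uxz; rewrite -osubr_ge0.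
  by apply: (Smin _ LU TU); exact: x_internal.1.
split=> [|S0]; split => //.
- by move=> _ [xs [xs0 <- ->]]; exact: rk_sum_le_majorant.
- move=> _ [xs [xs0 xsx ->]].
  apply: (le_trans (rk_sum_le_majorant Slin TS xs0)).
  have := S0 (x - \sum_j xs j); rewrite osubr_ge0 => /(_ xsx).
  by rewrite addrC -scaleN1r Slin scaleN1r addrC osubr_ge0.
- by move=> z zub; apply: Sx_least => y /rk_sums_eq_le; exact: zub.
Qed.
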